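(* Suppose that $\nu$ is an algebraic discrete valuation dominating a local domain $(R,\mathfrak{m}_R)$, and that the residue field $V_{\nu}/\mathfrak{m}_{\nu}$ is a finite extension of $R/\mathfrak{m}_R$. Then $$\lim_{n \to \infty} \frac{\ell_R(R/I_n)}{n^2}=0.$$
   Context: Local rings are Noetherian. Let $K$ be the quotient field of the local domain $(R,\mathfrak{m}_R)$. For a valuation $\nu$ of $K$, $V_{\nu}=\{f\in K\mid \nu(f)\ge 0\}$ is its valuation ring, with maximal ideal $\mathfrak{m}_{\nu}=\{f\in K\mid \nu(f)>0\}$. The valuation $\nu$ dominates $R$ if $R\subset V_{\nu}$ and $R\cap \mathfrak{m}_{\nu}=\mathfrak{m}_R$. It is discrete if its value group is order isomorphic to $\mathbb{Z}$ (and the value group is then identified with $\mathbb{Z}$). A discrete valuation dominating $R$ is algebraic if the residue field extension $V_{\nu}/\mathfrak{m}_{\nu}$ of $R/\mathfrak{m}_R$ is algebraic. For $n\in\mathbb{Z}_{\ge 0}$, $I_n=\{f\in R\mid \nu(f)\ge n\}$. $\ell_R$ denotes length as an $R$-module. *)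

(* Defs.v *)
From HB Require Import structures.
From mathcomp Require Import all_boot all_order all_algebra.
From mathcomp Require Import generic_quotient ring_quotient fraction.
From mathcomp Require Import boolp classical_sets constructive_ereal reals.
From mathcomp Require Import ereal topology sequences normedtype.

Set Implicit Arguments.
Unset Strict Implicit.
Unset Printing Implicit Defensive.

Import Order.TTheory GRing.Theory Num.Theory.

Local Open Scope ring_scope.
Local Open Scope quotient_scope.
Local Open Scope classical_set_scope.

(* A chain c 0 < ... < c k of submodules has length k; the length of a module *)
(* is the supremum, +oo for a module of infinite length.                      *)

Section Length.
Variables (A : nzRingType) (M : lmodType A).

Definition submodule_chain (k : nat) (c : nat -> {pred M}) : Prop :=
  (forall i, (i <= k)%N -> GRing.submod_closed (c i)) /\
  (forall i, (i < k)%N ->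
    {subset c i <= c i.+1} /\ ~ {subset c i.+1 <= c i}).

Definition module_length (F : realType) : \bar F :=
  ereal_sup [set (k%:R)%:E | k in [set k | exists c, submodule_chain k c]].

End Length.

Section QuotientModule.
Variables (A : nzRingType) (M : lmodType A) (N : submodClosed M).

(* The library's submodClosed is stated for semimodules; over a ring, closure *)
(* under opposite follows.                                                    *)
Fact submod_zmod_closed : zmod_closed N.
Proof. exact: GRing.submod_closedB (submodClosedP N). Qed.

Definition submod_zmod : zmodClosed M :=
  HB.pack (N : {pred M}) (GRing.isZmodClosed.Build M (N : {pred M}) submod_zmod_closed).

Definition quotient_module : Type := Quotient.quot submod_zmod.

HB.instance Definition _ := GRing.Zmodule.on quotient_module.

Definition quotient_scale (a : A) (x : quotient_module) : quotient_module :=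
  \pi_(Quotient.quot submod_zmod) (a *: repr x).

Lemma quotient_scale_pi a (u : M) :
  quotient_scale a (\pi_(Quotient.quot submod_zmod) u) = \pi_(Quotient.quot submod_zmod) (a *: u).
Proof.
apply/eqP; rewrite -[_ == _]Quotient.idealrBE -scalerBr.
apply: (@rpredZ _ _ N); have:= eqxx (\pi_(Quotient.quot submod_zmod) u).
by rewrite -{1}[\pi_ _ u]reprK -Quotient.idealrBE.
Qed.

Let piD (u v : M) : \pi_(Quotient.quot submod_zmod) (u + v) =
  \pi_(Quotient.quot submod_zmod) u + \pi_(Quotient.quot submod_zmod) v :> quotient_module.
Proof. exact: Quotient.pi_add. Qed.

Let piP (x : quotient_module) : exists u, x = \pi_(Quotient.quot submod_zmod) u.
Proof. by exists (repr (x : Quotient.quot submod_zmod)); rewrite reprK. Qed.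

Let quotient_scaleA a b x :
  quotient_scale a (quotient_scale b x) = quotient_scale (a * b) x.
Proof. by have [u ->] := piP x; rewrite !quotient_scale_pi scalerA. Qed.

Let quotient_scale1 : left_id 1 quotient_scale.
Proof. by move=> x; have [u ->] := piP x; rewrite quotient_scale_pi scale1r. Qed.

Let quotient_scaleDr : right_distributive quotient_scale +%R.
Proof.
move=> a x y; have [u ->] := piP x; have [v ->] := piP y.
by rewrite -piD !quotient_scale_pi scalerDr piD.
Qed.

Let quotient_scaleDl x : {morph quotient_scale^~ x : a b / a + b}.
Proof.
by move=> a b; have [u ->] := piP x; rewrite !quotient_scale_pi scalerDl piD.
Qed.

HB.instance Definition _ := GRing.Zmodule_isLmodule.Build A quotient_module
  quotient_scaleA quotient_scale1 quotient_scaleDr quotient_scaleDl.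

End QuotientModule.

(* idealr_closed J includes 1 \notin J, so J ranges over the proper ideals.    *)
Definition maximal_ideal (A : comNzRingType) (S : {pred A}) : Prop :=
  forall J : {pred A},
    idealr_closed J -> {subset S <= J} -> {subset J <= S}.

HB.mixin Record isMaximalIdealr (A : comNzRingType) (S : A -> bool) := {
  maximal_idealr_subproof : maximal_ideal S
}.

#[short(type="maximal_idealr")]
HB.structure Definition MaximalIdealr (A : comNzRingType) :=
  {S of Idealr A S & isMaximalIdealr A S}.

Section ResidueField.
Variables (A : comNzRingType) (m : maximal_idealr A).

Definition residue_field : Type := {ideal_quot m}.

HB.instance Definition _ := GRing.ComNzRing.on residue_field.

Definition residue (x : A) : residue_field := \pi_{ideal_quot m} x.

Lemma residue_eq x y : (residue x == residue y) = (x - y \in m).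
Proof. by rewrite Quotient.idealrBE. Qed.

Lemma residueK (z : residue_field) :
  residue (repr (z : {ideal_quot m})) = z.
Proof. exact: reprK. Qed.

Fact residue_is_zmod_morphism : zmod_morphism residue.
Proof. exact: (raddfB \pi_{ideal_quot m}). Qed.

Fact residue_is_monoid_morphism : monoid_morphism residue.
Proof.
by split; [exact: (rmorph1 \pi_{ideal_quot m})
          |exact: (rmorphM \pi_{ideal_quot m})].
Qed.

HB.instance Definition _ :=
  GRing.isZmodMorphism.Build A residue_field residue residue_is_zmod_morphism.
HB.instance Definition _ :=
  GRing.isMonoidMorphism.Build A residue_field residue
    residue_is_monoid_morphism.

Definition residue_inv (z : residue_field) : residue_field :=
  xget 0 [set w | w * z = 1].

Fact residue_mulVf (z : residue_field) : z != 0 -> residue_inv z * z = 1.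
Proof.
rewrite -[z]residueK; set x := repr _ => x0.
suff [a ha] : exists a, a * x - 1 \in m.
  rewrite /residue_inv; case: xgetP => //= /(_ (residue a)) [].
  by apply/eqP; rewrite -rmorphM -(rmorph1 residue) residue_eq.
apply: contrapT => hN.
pose J : {pred A} := fun z => `[< exists a, z - a * x \in m >].
have JE y : reflect (exists a, y - a * x \in m) (y \in J) by exact: asboolP.
suff : x \in m.
  by rewrite -[x]subr0 -residue_eq rmorph0 (negbTE x0).
apply: (@maximal_idealr_subproof _ m J); first split.
- by apply/JE; exists 0; rewrite mul0r subr0 rpred0.
- apply/JE => -[a ha]; apply: hN; exists a.
  by rewrite -rpredN opprB.
- move=> a u v /JE[b hb] /JE[c hc]; apply/JE; exists (a * b + c).
  rewrite mulrDl opprD addrACA rpredD // -mulrA -mulrBr.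
  exact: idealMr.
- by move=> y ym; apply/JE; exists 0; rewrite mul0r subr0.
- by apply/JE; exists 1; rewrite mul1r subrr rpred0.
Qed.

Fact residue_inv0 : residue_inv 0 = 0.
Proof.
rewrite /residue_inv; case: xgetP => //= w _ /eqP.
by rewrite mulr0 eq_sym oner_eq0.
Qed.

HB.instance Definition _ := GRing.ComNzRing_isField.Build residue_field
  residue_mulVf residue_inv0.

End ResidueField.

Definition noetherian (A : comNzRingType) : Prop :=
  forall J : {pred A^o}, GRing.submod_closed J ->
    exists s : seq A, forall x, x \in J <->
      exists a : 'I_(size s) -> A, x = \sum_i a i * s`_i.

Definition local_ring (A : comNzRingType) (m : maximal_idealr A) : Prop :=
  noetherian A /\ (forall n : maximal_idealr A, n =i m).

Definition finite_extension (k l : fieldType) (phi : {rmorphism k -> l}) :=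
  exists s : seq l, forall z, exists a : 'I_(size s) -> k,
    z = \sum_i phi (a i) * s`_i.

(* A discrete valuation, with its value group identified with the integers    *)
(* (hence normalized to be surjective onto them) and nu(0) = +oo.             *)

Record discrete_valuation (K : fieldType) := DiscreteValuation {
  dval :> K -> \bar int;
  dval0 : dval 0 = +oo%E;
  dval_fin : forall x, x != 0 -> exists n : int, dval x = n%:E;
  dval_surj : forall n : int, exists2 x, x != 0 & dval x = n%:E;
  dvalM : forall x y, dval (x * y) = (dval x + dval y)%E;
  dvalD : forall x y, (Order.min (dval x) (dval y) <= dval (x + y)%R)%E
}.

Section ValuationRing.
Variables (K : fieldType) (nu : discrete_valuation K).

Lemma dval1 : nu 1 = 0%E.
Proof.
have [n hn] := dval_fin nu (oner_neq0 K).
have := dvalM nu 1 1; rewrite mulr1 hn => -[] /eqP.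
by rewrite -subr_eq subrr => /eqP <-.
Qed.

Lemma dvalN1 : nu (- 1) = 0%E.
Proof.
have n1 : - 1 != 0 :> K by rewrite oppr_eq0 oner_eq0.
have [n hn] := dval_fin nu n1.
have := dvalM nu (- 1) (- 1); rewrite mulrNN mulr1 dval1 hn => -[] /eqP.
by rewrite eq_sym -mulr2n mulrn_eq0 /= => /eqP ->.
Qed.

Lemma dvalN x : nu (- x) = nu x.
Proof. by rewrite -mulN1r dvalM dvalN1 add0e. Qed.

Lemma dval_leD c x y : (c <= nu x)%E -> (c <= nu y)%E -> (c <= nu (x + y)%R)%E.
Proof. by move=> cx cy; apply: le_trans (dvalD nu x y); rewrite le_min cx. Qed.

Lemma dval_ltD c x y : (c < nu x)%E -> (c < nu y)%E -> (c < nu (x + y)%R)%E.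
Proof. by move=> cx cy; apply: lt_le_trans (dvalD nu x y); rewrite lt_min cx. Qed.

Definition valuation_pred : {pred K} := fun x => (0 <= nu x)%E.

Fact valuation_pred_subring : subring_closed valuation_pred.
Proof.
split=> [|x y hx hy|x y hx hy]; rewrite /in_mem /= /valuation_pred.
- by rewrite dval1.
- by apply: dval_leD => //; rewrite dvalN.
- by rewrite dvalM adde_ge0.
Qed.

HB.instance Definition _ :=
  GRing.isSubringClosed.Build K valuation_pred valuation_pred_subring.

Definition valuation_ring := {x : K | x \in valuation_pred}.

HB.instance Definition _ := SubType.on valuation_ring.
HB.instance Definition _ := Choice.on valuation_ring.
HB.instance Definition _ := [SubChoice_isSubComNzRing of valuation_ring by <:].

Definition valuation_ideal : {pred valuation_ring} :=
  fun x => (0 < nu (val x))%E.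

Fact valuation_ideal_closed : idealr_closed valuation_ideal.
Proof.
split=> [||a u v hu hv]; rewrite /in_mem /= /valuation_ideal.
- by rewrite rmorph0 dval0.
- by rewrite rmorph1 dval1 ltxx.
- rewrite rmorphD rmorphM; apply: dval_ltD => //.
  rewrite dvalM; have := valP a; rewrite /in_mem /= /valuation_pred.
  move: hu; rewrite /in_mem /= /valuation_ideal => hu ha.
  by apply: (lt_le_trans hu); rewrite -[leLHS]add0e; apply: leeD.
Qed.

HB.instance Definition _ :=
  isIdealr.Build valuation_ring valuation_ideal valuation_ideal_closed.

Fact valuation_ideal_maximal : maximal_ideal valuation_ideal.
Proof.
move=> J [J0 J1 Jlin] _ y yJ; rewrite /in_mem /= /valuation_ideal lt_neqAle.
have y0 : (0 <= nu (val y))%E by exact: (valP y).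
rewrite y0 andbT; apply/negP => /eqP nuy.
have yn0 : val y != 0.
  by apply/eqP => y_eq0; move: nuy; rewrite y_eq0 dval0.
have Vv : (val y)^-1 \in valuation_pred.
  have := dvalM nu (val y)^-1 (val y).
  by rewrite mulVf // dval1 -nuy adde0 /in_mem /= /valuation_pred => <-.
move/negP: J1; apply.
have -> : 1 = Sub (val y)^-1 Vv * y + 0 :> valuation_ring.
  by apply: val_inj; rewrite /= addr0 mulVf.
exact: Jlin.
Qed.

HB.instance Definition _ := isMaximalIdealr.Build valuation_ring
  valuation_ideal valuation_ideal_maximal.

End ValuationRing.

Arguments valuation_ideal {K} nu.

Section Domination.
Variables (R : idomainType) (m : maximal_idealr R).
Variable nu : discrete_valuation {fraction R}.

Local Notation "x %:F" := (@FracField.tofrac R x).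

Definition dominates : Prop :=
  (forall x : R, x%:F \in valuation_pred nu) /\
  (forall x : R, (x \in m) = (0 < nu (x%:F))%E).

Hypothesis dom : dominates.

Definition val_emb (x : R) : valuation_ring nu := Sub x%:F (dom.1 x).

Definition residue_extension (z : residue_field m) :
    residue_field (valuation_ideal nu) :=
  residue (valuation_ideal nu) (val_emb (repr (z : {ideal_quot m}))).

Lemma residue_extensionE (x : R) :
  residue_extension (residue m x) = residue (valuation_ideal nu) (val_emb x).
Proof.
apply/eqP; rewrite residue_eq /in_mem /= /valuation_ideal /=.
rewrite -tofracB -dom.2 -residue_eq residueK //.
Qed.

Fact residue_extension_is_zmod_morphism : zmod_morphism residue_extension.
Proof.
move=> x y; rewrite -[x]residueK -[y]residueK -rmorphB !residue_extensionE.
by rewrite -rmorphB; congr residue; apply: val_inj; rewrite /= tofracB.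
Qed.

Fact residue_extension_is_monoid_morphism : monoid_morphism residue_extension.
Proof.
split=> [|x y].
  rewrite -(rmorph1 (residue m)) residue_extensionE.
  rewrite -(rmorph1 (residue _)); congr residue.
  by apply: val_inj; rewrite /= tofrac1.
rewrite -[x]residueK -[y]residueK -rmorphM !residue_extensionE.
by rewrite -rmorphM; congr residue; apply: val_inj; rewrite /= tofracM.
Qed.

HB.instance Definition _ := GRing.isZmodMorphism.Build
  (residue_field m) (residue_field (valuation_ideal nu)) residue_extension
  residue_extension_is_zmod_morphism.
HB.instance Definition _ := GRing.isMonoidMorphism.Build
  (residue_field m) (residue_field (valuation_ideal nu)) residue_extension
  residue_extension_is_monoid_morphism.

Definition algebraic_valuation : Prop :=
  forall z, algebraicOver residue_extension z.

Definition value_ideal (n : nat) : {pred R^o} :=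
  fun x => ((n%:Z)%:E <= nu (x%:F))%E.

Fact value_ideal_closed n : GRing.subsemimod_closed (value_ideal n).
Proof.
apply: GRing.submod_closed_semi; split=> [|a u v hu hv].
  by rewrite /in_mem /= /value_ideal tofrac0 dval0 leey.
rewrite /in_mem /= /value_ideal tofracD; apply: dval_leD => //.
rewrite tofracM dvalM -[leLHS]add0e; apply: leeD => //.
exact: dom.1.
Qed.

Definition value_submod (n : nat) : submodClosed R^o :=
  HB.pack (value_ideal n)
    (GRing.isSubmodClosed.Build R R^o (value_ideal n) (value_ideal_closed n)).

End Domination.

(* Main.v *)
Require Import Defs.
From mathcomp Require Import all_boot all_order all_algebra fraction.
From mathcomp Require Import classical_sets constructive_ereal reals.
From mathcomp Require Import topology normedtype ereal sequences.
From mathcomp Require Import generic_quotient ring_quotient boolp.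
From mathcomp Require Import zify ring lra.

(* Let d be the number of generators of the residue field of nu over that of  *)
(* R.  Each I_j / I_(j+1) embeds in that residue field, so the length of      *)
(* R / I_n is at most n d, and dividing by n ^ 2 gives the limit 0. The bound *)
(* is obtained without composition series: given a strict chain of ideals C_i *)
(* containing I_n, pick x_i in C_(i+1) \ C_i of largest value, which is less  *)
(* than n.  The leading residues of the x_i of a same value j are linearly    *)
(* independent, because a dependence relation with last coefficient 1 lifts   *)
(* to an element of C_(i+1) \ C_i of value greater than j.  So each value is  *)
(* taken at most d times.                                                     *)

Set Implicit Arguments.
Unset Strict Implicit.
Unset Printing Implicit Defensive.

Import Order.TTheory GRing.Theory Num.Theory.
Local Open Scope ring_scope.
Local Open Scope quotient_scope.
Local Open Scope classical_set_scope.

(** The length of R / I_n grows at most linearly in n. [chain_length_le] bounds the ideal chains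
    above I_n: by [exists_max_value] each step has a value below n, and [linear_dependence] limits
    how often a value recurs. [quotient_chain_lift] carries the bound to R / I_n, and comparison
    with [harmonic] gives the limit. *)

Lemma submodule_chain_le {A : nzRingType} {M : lmodType A} k
    (c : nat -> {pred M}) i j :
  submodule_chain k c -> (i <= j <= k)%N -> {subset c i <= c j}.
Proof.
case=> _ lec /andP[]; elim: j => [|j IH] ij jk.
  by move: ij; rewrite leqn0 => /eqP ->.
move: ij; rewrite leq_eqVlt => /predU1P[-> //|ij] x xi.
by apply: (lec j jk).1; apply: IH => //; exact: ltnW.
Qed.

(** The lifts are preimages under the projection [p]. They contain [N] because [p] kills it, and
    inclusions stay strict because [p] is surjective. *)
Lemma quotient_chain_lift {A : nzRingType} {M : lmodType A}
    (N : submodClosed M) k (c : nat -> {pred quotient_module N}) :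
  submodule_chain k c ->
  exists2 c' : nat -> {pred M}, submodule_chain k c' &
    forall i, (i <= k)%N -> {subset N <= c' i}.
Proof.
move=> [sub lt].
pose p (u : M) : quotient_module N := \pi_(Quotient.quot (submod_zmod N)) u.
have pD u v : p (u + v) = p u + p v by exact: Quotient.pi_add.
have p0 u : u \in N -> p u = 0.
  have p00 : p 0 = 0 by apply: (addrI (p 0)); rewrite -pD !addr0.
  move=> uN; apply/eqP; rewrite -p00 /p.
  by rewrite -[_ == _]Quotient.idealrBE subr0.
have plin a u v : p (a *: u + v) = a *: p u + p v.
  by rewrite pD; congr (_ + _); rewrite /p -quotient_scale_pi.
have psurj x : exists u, p u = x.
  by exists (repr (x : Quotient.quot (submod_zmod N))); exact: reprK.
pose c' i : {pred M} := fun u => p u \in c i.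
have c'E i u : (u \in c' i) = (p u \in c i) by [].
exists c'.
  split=> i ik; first split=> [|a u v].
  - by rewrite c'E p0 ?rpred0 //; case: (sub i ik).
  - by rewrite !c'E plin; case: (sub i ik) => _; apply.
  - have [le nle] := lt i ik; split=> [u|h]; first by rewrite !c'E; exact: le.
    by apply: nle => x; have [u <-] := psurj x; exact: (h u).
by move=> i ik u uN; rewrite c'E p0 //; case: (sub i ik).
Qed.

Lemma leq_card_fibers k n d (f : 'I_k -> 'I_n) :
  (forall j, #|[set i | f i == j]%SET| <= d)%N -> (k <= n * d)%N.
Proof.
move=> fd; rewrite -{1}[k]card_ord -sum1_card.
rewrite (partition_big f predT) //= mulnC -[n in (_ * n)%N]card_ord.
rewrite mulnC -sum_nat_const; apply: leq_sum => j _.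
by apply: leq_trans (fd j); rewrite sum1dep_card.
Qed.

(** The coordinates of the [w i] along [s] form a matrix with more rows than columns; a nonzero row
    of its left kernel is the relation. *)
Lemma linear_dependence {k l : fieldType} (phi : {rmorphism k -> l})
    (s : seq l) r (w : 'I_r -> l) :
  (forall z, exists a : 'I_(size s) -> k, z = \sum_i phi (a i) * s`_i) ->
  (size s < r)%N ->
  exists2 u : 'I_r -> k, \sum_i phi (u i) * w i = 0 & exists i, u i != 0.
Proof.
move=> gen lt_r; have [a aE] := choice (fun i => gen (w i)).
pose M := \matrix_(i, j) a i j.
have: kermx M != 0.
  rewrite kermx_eq0 /row_free; apply/eqP => rM.
  by have := rank_leq_col M; rewrite rM leqNgt lt_r.
case/matrix0Pn => i0 [j0 nz]; exists (kermx M i0); last by exists j0.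
under eq_bigr => i _ do rewrite aE mulr_sumr.
rewrite exchange_big big1 //= => j _.
under eq_bigr => i _ do rewrite mulrA -rmorphM.
rewrite -mulr_suml -rmorph_sum.
have /matrixP/(_ i0 j) := mulmx_ker M; rewrite [LHS]mxE [RHS]mxE => E.
under eq_bigr => i _ do rewrite -[a i j](mxE matrix_key a).
by rewrite E rmorph0 mul0r.
Qed.

Section ChainBound.
Variables (R : idomainType) (m : maximal_idealr R).
Variables (nu : discrete_valuation {fraction R}) (dom : dominates m nu).

Local Notation "x %:F" := (@FracField.tofrac R x).
Local Notation phi := (residue_extension dom).

Lemma dval_nat (x : R) : x != 0 -> exists j : nat, nu x%:F = (j%:Z)%:E.
Proof.
rewrite -tofrac_eq0 => /(dval_fin nu)[v vE].
have := dom.1 x; rewrite /in_mem /= /valuation_pred vE lee_fin.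
by case: v vE => // j E _; exists j.
Qed.

(** Since [C] contains I_n, elements outside [C] have value below [n], so a largest value is
    attained. *)
Lemma exists_max_value n (C D : {pred R^o}) :
  GRing.submod_closed C -> {subset value_ideal nu n <= C} ->
  ~ {subset D <= C} ->
  exists (x : R) (j : 'I_n), [/\ x \in D, x \notin C, nu x%:F = (j%:Z)%:E &
    forall y : R, y \in D -> y \notin C -> (nu y%:F <= (j%:Z)%:E)%E].
Proof.
move=> [C0 _] nC nDC.
have val_lt (x : R) : x \notin C -> exists j : 'I_n, nu x%:F = (j%:Z)%:E.
  move=> xC; have [|j jE] := @dval_nat x.
    by apply: contraNneq xC => ->.
  have jn : (j < n)%N.
    rewrite ltnNge; apply: contra xC => nj; apply: nC.
    by rewrite /in_mem /= /value_ideal jE lee_fin.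
  by exists (Ordinal jn).
pose P (j : nat) := `[< exists x : R,
  [/\ x \in D, x \notin C & nu x%:F = (j%:Z)%:E] >].
have [x xD xC] : exists2 x : R, x \in D & x \notin C.
  apply: contrapT => h; apply: nDC => x xD; apply: contrapT => /negP xC.
  by apply: h; exists x.
have exP : exists j, P j.
  by have [j jE] := val_lt x xC; exists j; apply/asboolP; exists x.
have ubP j : P j -> (j <= n)%N.
  move=> /asboolP[y [_ yC]]; have [i ->] := val_lt y yC => -[<-].
  exact: ltnW.
case: (ex_maxnP exP ubP) => j /asboolP[y [yD yC yE]] jmax.
have [i iE] := val_lt y yC.
have ij : nat_of_ord i = j by move: iE; rewrite yE => -[].
exists y, i; split=> // z zD zC; have [l lE] := val_lt z zC.
rewrite lE lee_fin lez_nat ij; apply: jmax; apply/asboolP.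
by exists z.
Qed.

Variable s : seq (residue_field (valuation_ideal nu)).
Hypothesis gen : forall z, exists a : 'I_(size s) -> residue_field m,
  z = \sum_i phi (a i) * s`_i.

Lemma chain_length_le n k (C : nat -> {pred R^o}) :
  submodule_chain k C ->
  (forall i, (i <= k)%N -> {subset value_ideal nu n <= C i}) ->
  (k <= n * size s)%N.
Proof.
move=> chC nC; have [subC ltC] := chC.
have ex (i : 'I_k) : exists xj : R * 'I_n,
    [/\ xj.1 \in C i.+1, xj.1 \notin C i, nu xj.1%:F = (xj.2%:Z)%:E &
    forall y : R, y \in C i.+1 -> y \notin C i -> (nu y%:F <= (xj.2%:Z)%:E)%E].
  have ik := ltnW (ltn_ord i); have [_ nle] := ltC i (ltn_ord i).
  have [x [j ?]] := @exists_max_value n _ _ (subC i ik) (nC i ik) nle.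
  by exists (x, j).
have [xj xjP] := choice ex.
apply: (@leq_card_fibers _ _ _ (fun i => (xj i).2)) => j.
set A := [set i | _]%SET; rewrite leqNgt; apply/negP => ltA.
(* Multiplying by [t] brings each [x r] to value 0, where it has a residue. *)
have [t t0 tE] := dval_surj nu (- j%:Z).
pose x (r : 'I_#|A|) : R := (xj (enum_val r)).1.
have xE r : nu (x r)%:F = (j%:Z)%:E.
  rewrite /x; have [_ _ -> _] := xjP (enum_val r).
  by have := enum_valP r; rewrite inE => /eqP ->.
have xC r : x r \in C (enum_val r).+1 by case: (xjP (enum_val r)).
have xnC r : x r \notin C (enum_val r) by case: (xjP (enum_val r)).
have xmax (r : 'I_#|A|) (y : R) :
    y \in C (enum_val r).+1 -> y \notin C (enum_val r) ->
    (nu y%:F <= (j%:Z)%:E)%E.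
  by rewrite -(xE r) => yC ynC; have [_ _ -> ] := xjP (enum_val r); apply.
have XP r : (x r)%:F * t \in valuation_pred nu.
  by rewrite /in_mem /= /valuation_pred dvalM xE tE -EFinD subrr.
pose X r : valuation_ring nu := Sub ((x r)%:F * t) (XP r).
have [u u0 [r1 ur1]] := @linear_dependence _ _ phi s _
  (fun r => residue (valuation_ideal nu) (X r)) gen ltA.
(* [r0] is the term of the relation highest in the chain, so the other terms lie in
   [C (enum_val r0)]. *)
pose r0 := [arg max_(r > r1 | u r != 0) (enum_val r : nat)].
have [ur0 r0max] : u r0 != 0 /\
    forall r, u r != 0 -> (enum_val r <= enum_val r0)%N.
  by rewrite /r0; case: arg_maxnP.
have C_add i y z : (i <= k)%N -> y \in C i -> z \in C i -> y + z \in C i.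
  by move=> ik yC zC; rewrite -[y]scale1r; case: (subC i ik) => _; apply.
have C_mul i (a y : R) : (i <= k)%N -> y \in C i -> a * y \in C i.
  move=> ik yC; rewrite -[a * y]addr0.
  by case: (subC i ik) => ? /(_ a y 0); apply.
(* The coefficient at r0 is lifted to 1, so that no unit of R is inverted.   *)
pose a r : R := if r == r0 then 1 else if u r == 0 then 0
  else repr (u r / u r0 : {ideal_quot m}).
have aE r : residue m (a r) = u r / u r0.
  rewrite /a; case: eqP => [->|_]; first by rewrite divff // rmorph1.
  by case: eqP => [->|_]; rewrite ?rmorph0 ?mul0r ?residueK.
pose z : R := \sum_(r | r != r0) a r * x r.
have r0k : (enum_val r0 < k)%N by exact: ltn_ord.
have zC : z \in C (enum_val r0).
  rewrite /z; elim/big_ind: _ => [|y y' yC y'C|r rr0].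
  - by case: (subC _ (ltnW r0k)).
  - exact: C_add (ltnW r0k) yC y'C.
  (* A zero coefficient was lifted to 0 itself, which removes every [x r] from above [r0]. *)
  - rewrite /a (negbTE rr0); case: eqP => [_|/eqP ur].
      by rewrite mul0r; case: (subC _ (ltnW r0k)).
    apply: C_mul (ltnW r0k) _; apply: submodule_chain_le chC _ _ (xC r).
    rewrite (ltnW r0k) andbT ltn_neqAle r0max // andbT.
    by apply: contra rr0 => /eqP/val_inj/enum_val_inj ->.
pose y : R := x r0 + z.
have yC : y \in C (enum_val r0).+1.
  by apply: (C_add _ _ _ r0k (xC r0)); exact: (ltC _ r0k).1.
have ynC : y \notin C (enum_val r0).
  apply: contra (xnC r0) => yC0.
  have -> : x r0 = y + (- 1) * z by rewrite mulN1r addrK.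
  by apply: C_add (ltnW r0k) yC0 _; exact: C_mul (ltnW r0k) zC.
have yE : y = \sum_r a r * x r.
  by rewrite (bigD1 r0) //= {1}/a eqxx mul1r.
pose Y := \sum_r val_emb dom (a r) * X r.
have YE : val Y = y%:F * t.
  rewrite yE /Y !rmorph_sum mulr_suml; apply: eq_bigr => r _.
  by rewrite /= tofracM mulrA.
(* This is the relation divided by [u r0]. It gives [y * t] positive value, so [y] has value above
   [j], against [xmax]. *)
have : residue (valuation_ideal nu) Y == residue (valuation_ideal nu) 0.
  have resE r : residue (valuation_ideal nu) (val_emb dom (a r) * X r) =
      phi (u r) * residue _ (X r) * phi (u r0)^-1.
    rewrite (rmorphM (residue (valuation_ideal nu))) /=.
    by rewrite -residue_extensionE aE rmorphM mulrAC.
  rewrite rmorph0 /Y rmorph_sum (eq_bigr _ (fun r _ => resE r)).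
  by rewrite -mulr_suml u0 mul0r.
rewrite residue_eq subr0 /in_mem /= /valuation_ideal YE dvalM tE.
have := xmax _ _ yC ynC; have [|v ->] := @dval_nat y.
  by apply: contraNneq ynC => ->; case: (subC _ (ltnW r0k)).
rewrite -EFinD lee_fin lte_fin; lia.
Qed.

Lemma module_length_value_le (F : realType) n :
  (module_length (quotient_module (value_submod dom n)) F
    <= ((n * size s)%:R)%:E)%E.
Proof.
apply: ge_ereal_sup => _ [k [c chc] <-]; rewrite lee_fin ler_nat.
have [C chC nC] := quotient_chain_lift chc.
exact: chain_length_le chC nC.
Qed.

End ChainBound.

Lemma module_length_ge0 (A : nzRingType) (M : lmodType A) (F : realType) :
  (0 <= module_length M F)%E.
Proof.
by apply: ereal_sup_ubound; exists 0%N => //; exists (fun _ _ => true).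
Qed.

(** The factor 2 pays for replacing [x] by [x + 1], as [x + 1 <= 2 * x]; with [x] = n the right side
    is a multiple of [harmonic n]. *)
Lemma linear_div_square_le (F : realFieldType) (d x : F) :
  0 <= d -> 1 <= x -> x * d * (x ^+ 2)^-1 <= 2 * d * (x + 1)^-1.
Proof.
move=> d0 x1; have x0 : x != 0 by lra.
have -> : x * d * (x ^+ 2)^-1 = d / x by field.
rewrite ler_pdivlMr; last lra.
rewrite mulrAC ler_pdivrMr; last lra.
have := mulr_ge0 d0 (_ : 0 <= x - 1); lra.
Qed.

Theorem corollary1p2 (F : realType) (R : idomainType) (m : maximal_idealr R)
    (locR : local_ring m) (nu : discrete_valuation {fraction R})
    (dom : dominates m nu)
    (alg : algebraic_valuation dom)
    (fin : finite_extension (residue_extension dom)) :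
  (module_length (quotient_module (value_submod dom n)) F
     * ((n%:R ^+ 2)^-1)%:E)%E @[n --> \oo] --> (0%R : F)%:E.
Proof.
have [s gen] := fin.
have inv_ge0 n : 0 <= (n%:R ^+ 2)^-1 :> F by rewrite invr_ge0 exprn_ge0.
apply: (@squeeze_cvge _ _ _ _ (fun=> 0%E) _
  (fun n => ((2 * (size s)%:R) * harmonic n)%:E)).
- apply: nearW => n; apply/andP; split.
    by rewrite mule_ge0 ?module_length_ge0 ?lee_fin.
  apply: (le_trans (lee_wpmul2r _ (module_length_value_le gen F n))).
    by rewrite lee_fin.
  (* At n = 0 the bound on the length is already 0. *)
  rewrite -EFinM lee_fin natrM /harmonic /=; case: n => [|n].
    by rewrite !mul0r !mulr_ge0 // invr_ge0.
  by rewrite -[n.+2%:R]natr1; apply: linear_div_square_le; rewrite ?ler1n.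
- exact: cvg_cst.
- apply: cvg_EFin; first exact: nearW.
  rewrite -[0%R](mulr0 (2 * (size s)%:R : F)).
  by apply: cvgMr; exact: cvg_harmonic.
Qed.
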